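(* Let $A\in\mathbb{R}^{m\times n}$, $\mathbf{b},\boldsymbol{\varphi}\in\mathbb{R}^m$, $\mathbf{c},\mathbf{d}\in\mathbb{R}^n$, and let $\Lambda\subseteq\mathbb{R}$ be an interval such that for every $\lambda\in\Lambda$ the linear program $$f_c(\lambda)=\min\{(\mathbf{c}+\lambda\mathbf{d})^t\mathbf{x}\ :\ A\mathbf{x}\le\mathbf{b},\ \mathbf{x}\ge 0\}$$ is feasible and has a finite optimal value. For $\lambda\in\Lambda$ define $$h_c(\lambda)=\min\{\boldsymbol{\varphi}^t\mathbf{y}\ :\ \mathbf{y}\in\mathbb{R}^m,\ \mathbf{b}^t\mathbf{y}\ge f_c(\lambda),\ A^t\mathbf{y}\le\mathbf{c}+\lambda\mathbf{d},\ \mathbf{y}\le 0\},$$ where this minimum is assumed to be finite for every $\lambda\in\Lambda$. Then $h_c:\Lambda\to\mathbb{R}$ is continuous at every $\lambda\in\Lambda$.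
   Context: Vector inequalities are componentwise. By strong duality $f_c(\lambda)=\max\{\mathbf{b}^t\mathbf{y}: A^t\mathbf{y}\le\mathbf{c}+\lambda\mathbf{d},\ \mathbf{y}\le0\}$, so $h_c(\lambda)$ is the minimum of $\boldsymbol{\varphi}^t\mathbf{y}$ over the set of optimal dual solutions (with no optimality tolerance). Continuity at a point of $\Lambda$ is relative to $\Lambda$. *)

(* Defs.v *)
(* MathComp-Analysis world; R : realType is the field of real numbers. *)
From HB Require Import structures.
From mathcomp Require Import all_boot all_order all_algebra.
From mathcomp Require Import all_classical all_reals all_analysis.

Set Implicit Arguments.
Unset Strict Implicit.
Unset Printing Implicit Defensive.

Import Order.TTheory GRing.Theory Num.Theory.
Import numFieldNormedType.Exports.

Local Open Scope classical_set_scope.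
Local Open Scope ring_scope.

Definition vle (R : realType) (k : nat) (u v : 'cV[R]_k) : Prop :=
  forall i : 'I_k, u i 0 <= v i 0.

Definition dot (R : realType) (k : nat) (u v : 'cV[R]_k) : R :=
  (u^T *m v) 0 0.

Definition primal_feasible (R : realType) (m n : nat)
    (A : 'M[R]_(m, n)) (b : 'cV[R]_m) : set 'cV[R]_n :=
  [set x | vle (A *m x) b /\ vle 0 x].

Definition primal_values (R : realType) (m n : nat)
    (A : 'M[R]_(m, n)) (b : 'cV[R]_m) (c d : 'cV[R]_n) (lam : R) : set R :=
  [set dot (c + lam *: d) x | x in primal_feasible A b].

(* The optimal value of a minimisation program is the infimum of its set of
   objective values.  The operator [inf] is total; it is the actual optimal
   value only when that set satisfies [has_inf], i.e. is nonempty (the program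
   is feasible) and bounded below (its optimal value is finite).  For linear
   programs the infimum is then attained, so it is the minimum. *)
Definition fc (R : realType) (m n : nat)
    (A : 'M[R]_(m, n)) (b : 'cV[R]_m) (c d : 'cV[R]_n) (lam : R) : R :=
  inf (primal_values A b c d lam).

Definition dual_optimal (R : realType) (m n : nat)
    (A : 'M[R]_(m, n)) (b : 'cV[R]_m) (c d : 'cV[R]_n) (lam : R)
    : set 'cV[R]_m :=
  [set y | [/\ fc A b c d lam <= dot b y,
               vle (A^T *m y) (c + lam *: d) & vle y 0]].

Definition hc_values (R : realType) (m n : nat)
    (A : 'M[R]_(m, n)) (b phi : 'cV[R]_m) (c d : 'cV[R]_n) (lam : R) : set R :=
  [set dot phi y | y in dual_optimal A b c d lam].

Definition hc (R : realType) (m n : nat)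
    (A : 'M[R]_(m, n)) (b phi : 'cV[R]_m) (c d : 'cV[R]_n) (lam : R) : R :=
  inf (hc_values A b phi c d lam).

(* Main.v *)
Require Import Defs.
From HB Require Import structures.
From mathcomp Require Import all_boot all_order all_algebra.
From mathcomp Require Import all_classical all_reals all_analysis.
From mathcomp Require Import lra.
Set Implicit Arguments.
Unset Strict Implicit.
Unset Printing Implicit Defensive.
Import Order.TTheory GRing.Theory Num.Theory.
Import numFieldNormedType.Exports.
Local Open Scope classical_set_scope.
Local Open Scope ring_scope.

(** The function [hc] is the value of a linear program in [y] whose objective
    and matrix are fixed: only the right-hand side moves with [lam].  The value
    of such a program is a maximum of finitely many linear functions of the
    right-hand side, as long as it is finite ([lp_value_max_linear]); hence it
    depends continuously on any parameter on which the right-hand side depends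
    continuously ([lp_value_continuous]).

    The max formula comes from Fourier-Motzkin elimination.  Adding the
    constraint [dot phi y <= t] to the program and eliminating [y] describes the
    epigraph of the value function by finitely many inequalities
    [0 <= u w + t * v] with [v >= 0] ([lp_epigraph_polyhedral]).  Those with
    [v > 0] are lower bounds [- u w / v] for [t], and the value is the largest
    of them; those with [v = 0] restrict [w] only and hold as soon as the
    program is feasible.

    In the program defining [hc] the right-hand side contains [fc] besides
    [c + lam *: d], so [fc] has to be continuous as well.  In [fc] itself the
    parameter sits in the objective, but a feasible point of the program of [hc]
    is a dual feasible [y0] with [fc <= dot b y0], and weak duality bounds
    [dot b y] by [fc] for every dual feasible [y].  So [fc] is the value of the
    dual program, where the parameter moves the right-hand side again, and the
    same continuity lemma, applied with objective [- b], gives its continuity.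
    Strong duality is thus supplied by the feasibility of the program of
    [hc]. *)

(** * Fourier-Motzkin elimination *)

Section LinearInequalities.
Context (R : realType).

Lemma vle0P k (u : 'cV[R]_k) : vle 0 u <-> forall i, 0 <= u i 0.
Proof. by split=> h i; have := h i; rewrite mxE. Qed.

Lemma vle_subr k (u v : 'cV[R]_k) : vle u v <-> vle 0 (v - u).
Proof. by split=> h i; have := h i; rewrite !mxE subr_ge0. Qed.

Lemma vle_col_mx k l (u u' : 'cV[R]_k) (v v' : 'cV[R]_l) :
  vle (col_mx u v) (col_mx u' v') <-> vle u u' /\ vle v v'.
Proof.
split=> [h | [hu hv] i].
  split=> i.
    by have := h (lshift l i); rewrite !col_mxEu.
  by have := h (rshift k i); rewrite !col_mxEd.
by rewrite !mxE; case: (fintype.split i) => j; [exact: hu | exact: hv].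
Qed.

Lemma vle_dot_scalar k (u y : 'cV[R]_k) (t : R) :
  vle (u^T *m y) t%:M <-> dot u y <= t.
Proof.
split=> [/(_ 0) | h i]; first by rewrite [t%:M _ _]mxE eqxx mulr1n.
by rewrite !ord1 [t%:M _ _]mxE eqxx mulr1n.
Qed.

Lemma dotNl k (u y : 'cV[R]_k) : dot (- u) y = - dot u y.
Proof. by rewrite /dot raddfN /= mulNmx mxE. Qed.

Lemma exists_between (I J : finType) (P : pred I) (Q : pred J)
    (l : I -> R) (u : J -> R) :
  (forall i j, P i -> Q j -> l i <= u j) ->
  exists t, (forall i, P i -> l i <= t) /\ (forall j, Q j -> t <= u j).
Proof.
move=> lu; case: (pickP P) => [i0 Pi0 | noP].
  exists (\big[Num.max/l i0]_(i | P i) l i); split=> [i Pi | j Qj].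
    exact: (le_bigmax_cond _ _ Pi).
  by apply: bigmax_le => [|i Pi]; exact: lu.
(* There is no lower bound, so [0] is as good as any other candidate when there
     is no upper bound either. *)
  exists (\big[Num.min/0]_(j | Q j) u j); split=> [i | j Qj].
  by rewrite noP.
exact: (bigmin_le_cond _ _ Qj).
Qed.

(** Nonnegative combinations of the rows of [t *: a <= w] that cancel [t]: a row
    with positive coefficient combined with one with negative coefficient, or a
    single row with zero coefficient, which is listed once for each [j].  All
    other pairs give the trivial inequality. *)
Definition fm_row r (a : 'cV[R]_r) (ij : 'I_r * 'I_r) : 'rV[R]_r :=
  let: (i, j) := ij in
  if (0 < a i 0) && (a j 0 < 0) then
    a i 0 *: delta_mx 0 j - a j 0 *: delta_mx 0 i
  else if a i 0 == 0 then delta_mx 0 i else 0.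

Definition fm_mx r (a : 'cV[R]_r) : 'M[R]_(#|{: 'I_r * 'I_r}|, r) :=
  \matrix_p fm_row a (enum_val p).

Lemma fm_row_mul r (a w : 'cV[R]_r) i j :
  (fm_row a (i, j) *m w) 0 0 =
  if (0 < a i 0) && (a j 0 < 0) then a i 0 * w j 0 - a j 0 * w i 0
  else if a i 0 == 0 then w i 0 else 0.
Proof.
rewrite /fm_row; case: ifP => _.
  by rewrite mulmxBl -!scalemxAl -!rowE !mxE.
by case: ifP => _; rewrite ?mul0mx -?rowE !mxE.
Qed.

Lemma fm_mx_ge0P r (a w : 'cV[R]_r) :
  vle 0 (fm_mx a *m w) <-> forall i j, 0 <= (fm_row a (i, j) *m w) 0 0.
Proof.
have E p : (fm_mx a *m w) p 0 = (fm_row a (enum_val p) *m w) 0 0.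
  by rewrite -(rowK (fun p => fm_row a (enum_val p)) p) -row_mul [RHS]mxE.
split=> [h i j | h p]; last by rewrite E mxE; case: (enum_val p).
by have := h (enum_rank (i, j)); rewrite E enum_rankK mxE.
Qed.

Lemma fm_mx_ge0 r (a : 'cV[R]_r) i j : 0 <= fm_mx a i j.
Proof.
rewrite mxE; case: (enum_val i) => k l /=.
case: ifP => [/andP[k0 l0] | _].
  rewrite !mxE subr_ge0; apply: (@le_trans _ _ 0).
    by rewrite mulr_le0_ge0 ?ler0n // ltW.
  by rewrite mulr_ge0 ?ler0n // ltW.
by case: ifP => _; rewrite !mxE ?ler0n.
Qed.

(** Elimination of one variable: the inequality of a pair [(i, j)] with
    [a j < 0 < a i] says that the lower bound [w j / a j] for [t] lies below the
    upper bound [w i / a i]. *)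
Lemma fm_mxP r (a w : 'cV[R]_r) :
  (exists t : R, vle (t *: a) w) <-> vle 0 (fm_mx a *m w).
Proof.
split=> [[t taw] | /fm_mx_ge0P h].
  apply/fm_mx_ge0P => i j; rewrite fm_row_mul.
  have /= := taw j; have /= := taw i; rewrite !mxE => wi wj.
  case: ifP => [/andP[ai aj] | _]; first by nra.
  by case: eqP wi => [-> | _ _]; rewrite ?mulr0.
have [] := @exists_between 'I_r 'I_r (fun j => a j 0 < 0) (fun i => 0 < a i 0)
             (fun j => w j 0 / a j 0) (fun i => w i 0 / a i 0).
  move=> j i aj ai; have := h i j; rewrite fm_row_mul ai aj /= => hij.
  rewrite ler_pdivlMr // mulrAC ler_ndivrMr //; lra.
move=> t [tl tu]; exists t => i; rewrite mxE.
have [ai | ai | ai] := ltgtP (a i 0) 0.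
- by rewrite -ler_ndivrMr // tl.
- by rewrite -ler_pdivlMr // tu.
- by have := h i i; rewrite fm_row_mul ai ltxx eqxx mulr0.
Qed.

(** The right-hand sides of the solvable systems form a polyhedral cone; the
    variables are eliminated one at a time.  Nonnegativity of [U] is what gives
    the objective bound [t] a nonnegative coefficient in
    [lp_epigraph_polyhedral]. *)
Lemma feasible_rhs_polyhedral k r (M : 'M[R]_(r, k)) :
  exists q (U : 'M[R]_(q, r)), (forall i j, 0 <= U i j) /\
    forall w, (exists y, vle (M *m y) w) <-> vle 0 (U *m w).
Proof.
elim: k r M => [|k IH] r M.
  exists r, 1%:M; split=> [i j | w]; first by rewrite mxE ler0n.
  rewrite mul1mx; split=> [[y] | w0]; first by rewrite [M]thinmx0 mul0mx.
  by exists 0; rewrite mulmx0.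
have {M} [a [N ->]] : exists (a : 'cV[R]_r) (N : 'M[R]_(r, k)), M = row_mx a N.
  by exists (@lsubmx _ r 1 k M), (@rsubmx _ r 1 k M);
    rewrite hsubmxK.
have mulE (t : R) (z : 'cV[R]_k) :
    @mulmx R r k.+1 1 (row_mx a N) (col_mx t%:M z) = t *: a + N *m z.
  by rewrite -mul_mx_scalar; exact: (@mul_row_col R r 1 k 1).
have [q [V [V0 HV]]] := IH _ (fm_mx a *m N).
exists q, (V *m fm_mx a); split=> [i j | w].
  by rewrite mxE sumr_ge0 // => l _; rewrite mulr_ge0 ?fm_mx_ge0.
rewrite -mulmxA -HV; split=> [[y] | [z hz]].
  rewrite -[y](@vsubmxK _ 1 k 1) [usubmx _]mx11_scalar mulE.
  set t := usubmx _ _ _; set z := dsubmx _ => h; exists z.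
  apply/vle_subr; rewrite -mulmxA -mulmxBr; apply/fm_mxP.
  by exists t => i; have := h i; rewrite !mxE -lerBrDr.
move/vle_subr: hz; rewrite -mulmxA -mulmxBr => /fm_mxP[t ht].
by exists (col_mx t%:M z) => i; have := ht i; rewrite mulE !mxE -lerBrDr.
Qed.

(** * The value of a linear program as a function of its right-hand side *)

Definition lp_values r k (M : 'M[R]_(r, k)) (phi : 'cV[R]_k) (w : 'cV[R]_r) :
  set R := [set dot phi y | y in [set y | vle (M *m y) w]].

Lemma lp_epigraph_polyhedral r k (M : 'M[R]_(r, k)) (phi : 'cV[R]_k) :
  exists q (U : 'M[R]_(q, r)) (v : 'cV[R]_q), vle 0 v /\
    forall w t, (exists2 s, lp_values M phi w s & s <= t) <->
      forall p, 0 <= (U *m w) p 0 + t * v p 0.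
Proof.
have [q [U [U0 HU]]] := feasible_rhs_polyhedral (col_mx M phi^T).
exists q, (lsubmx U), (rsubmx U); split=> [p | w t]; first by rewrite !mxE.
have E p : (lsubmx U *m w) p 0 + t * rsubmx U p 0 =
           (U *m col_mx w t%:M) p 0.
  by rewrite -{3}[U]hsubmxK mul_row_col mul_mx_scalar [RHS]mxE [X in _ = _ + X]mxE.
have -> : (exists2 s, lp_values M phi w s & s <= t) <->
          (exists y, vle (col_mx M phi^T *m y) (col_mx w t%:M)).
  split=> [[_ [y yw <-] yt] | [y]].
    by exists y; rewrite mul_col_mx; apply/vle_col_mx; split=> //; apply/vle_dot_scalar.
  rewrite mul_col_mx => /vle_col_mx[yw /vle_dot_scalar yt].
  by exists (dot phi y) => //; exists y.
by rewrite HU vle0P; split=> h p; have := h p; rewrite E.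
Qed.

(** A single right-hand side with finite value yields a row [p0] with positive
    [t]-coefficient: without one, the epigraph inequalities would not involve [t]
    and the values would be unbounded below.  Rows without such a coefficient
    are replaced by [p0], so that the maximum can run over all rows. *)
Lemma lp_value_max_linear r k (M : 'M[R]_(r, k)) (phi : 'cV[R]_k) w0 :
  has_inf (lp_values M phi w0) ->
  exists q (V : 'M[R]_(q, r)) (p0 : 'I_q), forall w,
    lp_values M phi w !=set0 ->
    inf (lp_values M phi w) =
      \big[Num.max/(V *m w) p0 0]_p (V *m w) p 0.
Proof.
have [q [U [v [v0 HU]]]] := lp_epigraph_polyhedral M phi.
move=> [[s0 s0P] [l lP]].
have Hv p : 0 <= v p 0 by have := v0 p; rewrite mxE.
have [p0 vp0] : exists p0, 0 < v p0 0.
  apply: contrapT => vn0.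
  have /HU[s /lP ls sl] : forall p, 0 <= (U *m w0) p 0 + (l - 1) * v p 0.
    have vE p : v p 0 = 0.
      by apply/eqP; rewrite eq_le Hv andbT leNgt; apply/negP => vp; apply: vn0; exists p.
    have /HU h : exists2 s, lp_values M phi w0 s & s <= s0 by exists s0.
    by move=> p; have := h p; rewrite vE !mulr0.
  by move: (le_trans ls sl); rewrite leNgt ltrBlDr ltrDl ltr01.
pose g p := if 0 < v p 0 then p else p0.
have vg p : 0 < v (g p) 0 by rewrite /g; case: ifP.
exists q, (\matrix_p (- (v (g p) 0)^-1 *: row (g p) U)), p0 => w [s sP].
set V := \matrix_p _.
have VE p : (V *m w) p 0 = - (U *m w) (g p) 0 / v (g p) 0.
  have -> : (V *m w) p 0 = (row p V *m w) 0 0.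
    by rewrite -row_mul [RHS]mxE.
  by rewrite rowK -scalemxAl -row_mul !mxE mulNr mulrC -mulNr.
have feasP t : (exists2 s, lp_values M phi w s & s <= t) <->
    forall p, (V *m w) p 0 <= t.
  rewrite HU; split=> [h p | h p].
    by rewrite VE ler_pdivrMr // lerNl -subr_ge0 opprK h.
  have [vp | vp] := ltP 0 (v p 0).
    by have := h p; rewrite VE [g p]ifT // ler_pdivrMr // lerNl -subr_ge0 opprK.
  have v0p : v p 0 = 0 by apply/eqP; rewrite eq_le vp Hv.
  have /HU/(_ p) : exists2 s', lp_values M phi w s' & s' <= s by exists s.
  by rewrite v0p !mulr0.
set m := \big[_/_]_p _.
have mP : forall p, (V *m w) p 0 <= m by move=> p; exact: (le_bigmax _ (fun p => (V *m w) p 0)).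
have lb x : lp_values M phi w x -> m <= x.
  move=> xP; have /feasP h : exists2 s, lp_values M phi w s & s <= x by exists x.
  exact: bigmax_le.
have /feasP[x xP xm] := mP.
apply/eqP; rewrite eq_le; apply/andP; split.
  by apply: le_trans xm; apply: ge_inf => //; exists m => y /lb.
by apply: lb_le_inf; [exists s | move=> y /lb].
Qed.

(** The default value of the maximum is allowed to vary too, because the
    maximum of [lp_value_max_linear] starts from the linear function of index
    [p0]. *)
Lemma cvg_bigmax (T I : Type) (F : set_system T) (FF : Filter F) (s : seq I)
    (f0 : T -> R) (f : I -> T -> R) (l0 : R) (l : I -> R) :
  f0 x @[x --> F] --> l0 -> (forall i, f i x @[x --> F] --> l i) ->
  \big[Num.max/f0 x]_(i <- s) f i x @[x --> F] --> \big[Num.max/l0]_(i <- s) l i.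
Proof.
move=> f0l fl; elim: s => [|i s IH].
  by rewrite big_nil; under eq_fun do rewrite big_nil.
rewrite big_cons maxr_absE; under eq_fun do rewrite big_cons maxr_absE.
apply: cvgM; last exact: cvg_cst.
by apply: cvgD; [exact: cvgD | apply: cvg_norm; exact: cvgB].
Qed.

(** The max formula obtained at one point of [L] is valid at all the others,
    so that near a point the value is a maximum of the same finitely many
    continuous functions. *)
Lemma lp_value_continuous (T : topologicalType) (L : set T) r k
    (M : 'M[R]_(r, k)) (phi : 'cV[R]_k) (w : T -> 'cV[R]_r) :
  (forall i, {within L, continuous (fun x => w x i 0)}) ->
  (forall x, L x -> has_inf (lp_values M phi (w x))) ->
  {within L, continuous (fun x => inf (lp_values M phi (w x)))}.
Proof.
move=> wC wP; apply/subspace_continuousP => x0 Lx0.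
have [q [V [p0 HV]]] := lp_value_max_linear (wP _ Lx0).
have VC p : (V *m w x) p 0 @[x --> within L (nbhs x0)] --> (V *m w x0) p 0.
  rewrite mxE; under eq_fun do rewrite mxE.
  apply: cvg_big => [|j _]; first exact: add_continuous.
  apply: cvgM; first exact: cvg_cst.
  by have /subspace_continuousP := wC j; apply.
rewrite /from_subspace (HV _ (wP _ Lx0).1).
apply: cvg_trans (cvg_bigmax _ (VC p0) VC).
apply: near_eq_cvg; apply: filterS (withinT _ _) => x Lx.
by rewrite HV //; exact: (wP _ Lx).1.
Qed.
End LinearInequalities.

(** * Continuity of [hc] *)

Theorem theorem7 (R : realType) (m n : nat)
    (A : 'M[R]_(m, n)) (b phi : 'cV[R]_m) (c d : 'cV[R]_n)
    (Lambda : set R) (hLambda : is_interval Lambda)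
    (hf : forall lam : R, Lambda lam -> has_inf (primal_values A b c d lam))
    (hh : forall lam : R, Lambda lam -> has_inf (hc_values A b phi c d lam)) :
  {within Lambda, continuous (hc A b phi c d)}.
Proof.
have weak x y lam : primal_feasible A b x ->
    vle (A^T *m y) (c + lam *: d) -> vle y 0 ->
    dot b y <= dot (c + lam *: d) x.
  move=> [Axb x0] Ay y0; apply: (@le_trans _ _ (dot (A *m x) y)).
    rewrite /dot !mxE; apply: ler_sum => i _; rewrite ![_^T _ _]mxE.
    by apply: ler_wnM2r; [have := y0 i; rewrite [X in _ <= X]mxE | exact: Axb].
  rewrite /dot trmx_mul -mulmxA.
  have -> : (x^T *m (A^T *m y)) 0 0 = ((A^T *m y)^T *m x) 0 0.
    by rewrite -[in RHS](trmxK x) -trmx_mul [RHS]mxE.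
  rewrite !mxE; apply: ler_sum => i _; rewrite ![_^T _ _]mxE.
  by apply: ler_wpM2r; [have := x0 i; rewrite mxE | exact: Ay].
(* The dual constraints as one system [D *m y <= rhs lam]. *)
pose D := col_mx A^T 1%:M.
pose rhs lam := col_mx (c + lam *: d) (0 : 'cV[R]_m).
have dualP lam y : vle (D *m y) (rhs lam) <-> vle (A^T *m y) (c + lam *: d) /\ vle y 0.
  by rewrite /D mul_col_mx mul1mx; exact: vle_col_mx.
have rhsC i : continuous (fun lam => rhs lam i 0).
  have [j -> | j ->] := split_ordP i; last first.
    have -> : (fun lam => rhs lam (rshift n j) 0) = cst 0.
      by apply/funext => lam; rewrite /rhs col_mxEd mxE.
    by move=> lam; exact: cvg_cst.
  have -> : (fun lam => rhs lam (lshift m j) 0) = (fun lam => c j 0 + lam * d j 0).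
    by apply/funext => lam; rewrite /rhs col_mxEu !mxE.
  move=> lam; apply: cvgD; first exact: cvg_cst.
  by apply: cvgM; [exact: cvg_id | exact: cvg_cst].
have fcE lam : Lambda lam ->
    has_inf (lp_values D (- b) (rhs lam)) /\
    fc A b c d lam = - inf (lp_values D (- b) (rhs lam)).
  move=> Ll; have [[_ [y0 [y0f Ay0 y00] _]] _] := hh _ Ll.
  have lb s : lp_values D (- b) (rhs lam) s -> - fc A b c d lam <= s.
    move=> [y /dualP[Ay yle0] <-].
    rewrite dotNl lerN2.
    apply: lb_le_inf; first exact: (hf _ Ll).1.
    by move=> _ [x xP <-]; exact: weak.
  have y0P : lp_values D (- b) (rhs lam) (- dot b y0).
    exists y0; first exact/dualP.
    exact: dotNl.
  have hi : has_inf (lp_values D (- b) (rhs lam)).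
    by split; [exists (- dot b y0) | exists (- fc A b c d lam) => s /lb].
  suff -> : inf (lp_values D (- b) (rhs lam)) = - fc A b c d lam by rewrite opprK.
  apply/eqP; rewrite eq_le; apply/andP; split.
    by apply: le_trans (ge_inf hi.2 y0P) _; rewrite lerN2.
  exact: lb_le_inf hi.1 lb.
have fcC : {within Lambda, continuous (fc A b c d)}.
  have : {within Lambda, continuous (fun lam => inf (lp_values D (- b) (rhs lam)))}.
    apply: lp_value_continuous => [i | lam /fcE[] //].
    exact: continuous_subspaceT.
  move=> /subspace_continuousP C; apply/subspace_continuousP => lam Ll.
  rewrite /from_subspace (fcE _ Ll).2.
  apply: cvg_trans (cvgN (C _ Ll)); apply: near_eq_cvg.
  by apply: filterS (withinT _ _) => x /fcE[_ ->].
(* The optimality constraint [fc <= dot b y] is appended with reversed sign. *)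
pose E := col_mx D (- b)^T.
pose rhs' lam := col_mx (rhs lam) (- fc A b c d lam)%:M.
have EP lam y : vle (E *m y) (rhs' lam) <-> dual_optimal A b c d lam y.
  rewrite /E mul_col_mx vle_col_mx dualP vle_dot_scalar dotNl lerN2.
  by split=> [[[]] | []].
have valE lam : hc_values A b phi c d lam = lp_values E phi (rhs' lam).
  rewrite /hc_values /lp_values; congr (image _ _).
  by apply/seteqP; split=> y /EP.
have -> : hc A b phi c d = fun lam => inf (lp_values E phi (rhs' lam)).
  by apply/funext => lam; rewrite /hc valE.
apply: lp_value_continuous => [i | lam Ll]; last by rewrite -valE; exact: hh.
have [j -> | j ->] := split_ordP i.
  have -> : (fun lam => rhs' lam (lshift 1 j) 0) = (fun lam => rhs lam j 0).
    by apply/funext => lam; rewrite /rhs' col_mxEu.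
  exact: continuous_subspaceT.
have -> : (fun lam => rhs' lam (rshift (n + m) j) 0) = (fun lam => - fc A b c d lam).
  by apply/funext => lam; rewrite /rhs' col_mxEd !mxE ord1 eqxx mulr1n.
by move=> x; apply: cvgN; exact: fcC.
Qed.
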